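(* Let $U\subseteq V$ be finite-dimensional $\mathbb{F}_q$-subspaces of $S$ and let $\mu\subseteq\lambda$ be partitions. (1) If the number of indices $i$ with $\lambda_i>\mu_i$ is strictly less than $\dim U$, then $$S_{\lambda/\mu}(V)=\sum_{L\subseteq U,\ \dim L=1}S_{\lambda/\mu}(V/L).$$ (2) If the number of indices $j$ with $\lambda'_j>\mu'_j$ is strictly less than $\dim U$, then $$T_{\lambda/\mu}(V)=\sum_{L\subseteq U,\ \dim L=1}T_{\lambda/\mu}(V/L).$$ Here the sums run over all one-dimensional $\mathbb{F}_q$-subspaces $L$ of $U$.
   Context: Let $q$ be a power of a prime $p$, $S=\mathbb{F}_q[x_1,\dots,x_n]$, $\widehat S=\bigcup_{r\ge0}\mathbb{F}_q[x_1^{q^{-r}},\dots,x_n^{q^{-r}}]$, $\varphi(u)=u^q$ the Frobenius automorphism of $\widehat S$. For a subspace $W\subset S$ of dimension $k$ with basis $w_1,\dots,w_k$ and strictly decreasing nonnegative integers $\alpha_1>\dots>\alpha_k$, $A_\alpha(W)=\det(w_i^{q^{\alpha_j}})_{i,j}$; for a partition $\lambda$ with at most $k$ nonzero parts, $S_\lambda(W)=A_{\lambda+\delta_k}(W)/A_{\delta_k}(W)$, $\delta_k=(k-1,\dots,0)$ (basis independent). $E_r(W)=S_{(1^r)}(W)$ for $0\le r\le k$ and $0$ otherwise; $H_r(W)=S_{(r)}(W)$ for $r\ge0$, $H_r(W)=0$ for $r<0$ (for $k=0$: $E_0=H_0=1$, others $0$). For partitions $\lambda,\mu$, $N=\max\{\ell(\lambda),\ell(\mu)\}$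 ($\ell$ = number of nonzero parts): $S_{\lambda/\mu}(W)=\det\big(\varphi^{\mu_j-j+1}H_{\lambda_i-\mu_j-i+j}(W)\big)_{1\le i,j\le N}$ and $T_{\lambda/\mu}(W)=\det\big((-1)^{\lambda_i-\mu_j-i+j}\varphi^{\lambda_i-i}E_{\lambda_i-\mu_j-i+j}(W)\big)_{1\le i,j\le N}$. $\lambda'$ denotes the conjugate partition. Quotients: for subspaces $L\subseteq V$ of $S$, $f_L(X)=\prod_{u\in L}(X+u)$ is an $\mathbb{F}_q$-linear map $S\to S$ with kernel $L$, and $V/L:=f_L(V)$, a subspace of $S$ of dimension $\dim V-\dim L$. $\mu\subseteq\lambda$ means $\mu_i\le\lambda_i$ for all $i$. *)

(* Defs.v *)
From HB Require Import structures.
From mathcomp Require Import all_boot all_order all_algebra all_field fraction.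
From mathcomp Require Import finmap.
From mathcomp Require Import mpoly.
From Stdlib Require Import ClassicalEpsilon.
Set Implicit Arguments. Unset Strict Implicit. Unset Printing Implicit Defensive.
Import Order.TTheory GRing.Theory Num.Theory.
Local Open Scope ring_scope.


Section Defs.
Variables (F : finFieldType) (n : nat).

Definition qq : nat := #|F|.
Definition Spol := {mpoly F[n]}.
Definition Kf := {fraction Spol}.
Definition toK (f : Spol) : Kf := tofrac f.

Definition is_subspace (W : {fset Spol}) : bool :=
  (0 \in W) && [forall a : F, forall u : W, forall v : W,
                   (a *: val u + val v) \in W].

Definition lincomb (b : seq Spol) (c : (size b).-tuple F) : Spol :=
  \sum_(i < size b) tnth c i *: nth 0 b i.

Definition is_free (b : seq Spol) : bool :=
  [forall c : (size b).-tuple F,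
     (lincomb c == 0) ==> (c == [tuple of nseq (size b) 0])].

Definition is_basis (W : {fset Spol}) (b : seq Spol) : bool :=
  all (fun w => w \in W) b && is_free b &&
  [forall w : W, [exists c : (size b).-tuple F, val w == lincomb c]].

Definition sbasis (W : {fset Spol}) : seq Spol :=
  epsilon (inhabits [::]) (fun b => is_basis W b).
Definition sdim (W : {fset Spol}) : nat := size (sbasis W).

(* alpha given 0-indexed: alpha j = alpha_{j+1} *)
Definition Adet (b : seq Spol) (alpha : nat -> nat) : Kf :=
  \det (\matrix_(i < size b, j < size b) toK (nth 0 b i) ^+ (qq ^ alpha j)).

(* S_lambda(W) = A_{lambda + delta_k}(W) / A_{delta_k}(W), lambda 0-indexed *)
Definition Schur (W : {fset Spol}) (lam : nat -> nat) : Kf :=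
  let b := sbasis W in let k := size b in
  Adet b (fun j => (lam j + (k - 1 - j))%N) / Adet b (fun j => (k - 1 - j)%N).

Definition Efun (W : {fset Spol}) (r : int) : Kf :=
  match r with
  | Posz m => if (m <= sdim W)%N then
                if sdim W == 0%N then 1 else Schur W (fun j => (j < m)%N : nat)
              else 0
  | Negz _ => 0
  end.

Definition Hfun (W : {fset Spol}) (r : int) : Kf :=
  match r with
  | Posz m => if sdim W == 0%N then (m == 0%N)%:R
              else Schur W (fun j => if j == 0%N then m else 0%N)
  | Negz _ => 0
  end.

(* ---------- partitions (as seq nat, 0-indexed: lambda_{i+1} = nth 0 l i) ---------- *)
Definition part (l : seq nat) (i : nat) : nat := nth 0%N l i.
Definition is_partition (l : seq nat) : bool := sorted geq l.
Definition plen (l : seq nat) : nat := count (fun x => 0 < x)%N l.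
(* conjugate partition: lambda'_j = #{i | lambda_i >= j}, j >= 1 *)
Definition conjp (l : seq nat) (j : nat) : nat := count (fun x => j <= x)%N l.
Definition psubset (m l : seq nat) : Prop := forall i, (part m i <= part l i)%N.

(* A pair (r, x) represents phi^{-r}(x) = x^{q^{-r}}.  Since phi is an
   injective ring endomorphism of Frac S, this is the perfect closure, and it
   contains \hat S (the pairs (r, f) with f in S). *)
Definition Shat := (nat * Kf)%type.
Definition shat_eq (a b : Shat) : Prop := a.2 ^+ (qq ^ b.1) = b.2 ^+ (qq ^ a.1).
Definition shat0 : Shat := (0%N, 0).
Definition shat_add (a b : Shat) : Shat :=
  ((a.1 + b.1)%N, a.2 ^+ (qq ^ b.1) + b.2 ^+ (qq ^ a.1)).

(* S_{lambda/mu}(W) = det(phi^{mu_j - j + 1} H_{lambda_i - mu_j - i + j}(W)),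
   N x N, N = max(l(lambda), l(mu)).  All entries lie in phi^{-N}(Frac S),
   so we represent the determinant as phi^{-N} of det(phi^N(entries)).
   Indices below are 0-indexed: i = i'+1, j = j'+1. *)
Definition skewS (W : {fset Spol}) (l m : seq nat) : Shat :=
  let N := maxn (plen l) (plen m) in
  (N, \det (\matrix_(i < N, j < N)
       Hfun W ((part l i)%:Z - (part m j)%:Z - i%:Z + j%:Z)
         ^+ (qq ^ (part m j + N - j)))).

(* T_{lambda/mu}(W) = det((-1)^{lambda_i - mu_j - i + j}
                         phi^{lambda_i - i} E_{lambda_i - mu_j - i + j}(W)) *)
Definition skewT (W : {fset Spol}) (l m : seq nat) : Shat :=
  let N := maxn (plen l) (plen m) in
  (N, \det (\matrix_(i < N, j < N)
       let e := ((part l i)%:Z - (part m j)%:Z - i%:Z + j%:Z)%R in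
       (-1) ^+ `|e|%N *
       Efun W e ^+ (qq ^ (part l i + N - i.+1)))).

Definition fL (L : {fset Spol}) (X : Spol) : Spol := \prod_(u <- L) (X + u).
Definition quot (V L : {fset Spol}) : {fset Spol} := [fset fL L v | v in V]%fset.

Definition sum_lines (U : {fset Spol}) (G : {fset Spol} -> Shat) : Shat :=
  \big[shat_add/shat0]_(L <- fpowerset U | is_subspace L && (sdim L == 1%N)) G L.

Definition nrows_diff (l m : seq nat) : nat :=
  count (fun i => part m i < part l i)%N (iota 0 (maxn (size l) (size m))).
Definition ncols_diff (l m : seq nat) : nat :=
  count (fun j => conjp m j < conjp l j)%N
        (iota 1 (maxn (\max_(x <- l) x) (\max_(x <- m) x))).

End Defs.

(* Main.v *)
Require Import Defs.
From HB Require Import structures.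
From mathcomp Require Import all_boot all_order all_fingroup all_algebra all_field.
From mathcomp Require Import fraction.
From mathcomp Require Import finmap.
From mathcomp Require Import mpoly.
From mathcomp Require Import zify ring.
From Stdlib Require ClassicalEpsilon.
Set Implicit Arguments. Unset Strict Implicit. Unset Printing Implicit Defensive.
Import GRing.Theory.
Local Open Scope ring_scope.

(**
  Let L = <l> be a line of U, a = l^(q-1) and k = dim V.  Since
  f_L(w) = w^q - a w, comparing the linearized relations satisfied by the
  vectors of V and of V/L gives, for the infinite triangular matrices
  h = (phi^(B+1) H_(A-B)) and t = (+- phi^A E_(A-B)),
    h_(A,B)(V/L) = h_(A,B)(V) - a^(q^(k+A-1)) h_(A-1,B)(V),
    t_(A,B)(V) = t_(A,B)(V/L) - a^(q^(k+B)) t_(A,B+1)(V/L).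
  The skew functions are minors of h and t.  Expanding multilinearly (for t, after
  subtracting from each column a multiple of the previous one, which makes
  column j a combination of t_(A,C)(V) with B_j <= C < B_(j-1)), the skew function
  of V/L becomes a sum of coefficients depending only on V times monomials
  prod_e a^(q^e).  A coefficient vanishes as soon as its monomial has at least
  dim U factors, because the minor then has a large zero block: this is where the
  number of rows (resp. columns) of lambda/mu enters.  For fewer factors,
  a Chevalley-Warning argument shows that the sum of prod_e l^((q-1) q^e)
  over the nonzero l in U is 0, or -1 for the empty product; as each line
  has q - 1 = -1 nonzero vectors, only the constant term, which is the skew
  function of V, survives the sum over lines.
*)

(** * Frobenius powers *)

Section FrobeniusPowers.
Variables (F : finFieldType) (K : fieldType) (io : {rmorphism F -> K}).
Local Notation q := #|F|.

Lemma q_gt1 : (1 < q)%N. Proof. exact: finNzRing_gt1. Qed.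

Lemma q_gt0 m : (0 < q ^ m)%N.
Proof. by rewrite expn_gt0 (ltnW q_gt1). Qed.

Lemma pchar_nat_q m : [pchar K].-nat (q ^ m)%N.
Proof.
have [p p_pr pF] := finPcharP F.
have pK : p \in [pchar K] := rmorph_pchar io pF.
rewrite (eq_pnat _ (pcharf_eq pK)) (card_pprimeChar pF) -expnM.
by rewrite pnatX pnat_id.
Qed.

Lemma natr_q : (q%:R : K) = 0.
Proof.
have [p p_pr pF] := finPcharP F.
have pK : p \in [pchar K] := rmorph_pchar io pF.
apply/eqP; rewrite -(dvdn_pcharf pK).
have := q_gt1; rewrite (card_pprimeChar pF).
by case: (logn _ _) => // m _; rewrite expnS dvdn_mulr.
Qed.

Lemma frobD m (x y : K) : (x + y) ^+ (q ^ m) = x ^+ (q ^ m) + y ^+ (q ^ m).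
Proof. exact: exprDn_pchar (pchar_nat_q m). Qed.

Lemma frob0 m : (0 : K) ^+ (q ^ m) = 0.
Proof. by rewrite expr0n gtn_eqF ?q_gt0. Qed.

Lemma frobN m (x : K) : (- x) ^+ (q ^ m) = - x ^+ (q ^ m).
Proof. by apply: (addrI (x ^+ (q ^ m))); rewrite -frobD !subrr frob0. Qed.

Lemma frobB m (x y : K) : (x - y) ^+ (q ^ m) = x ^+ (q ^ m) - y ^+ (q ^ m).
Proof. by rewrite frobD frobN. Qed.

Lemma frobS m (x : K) : (x ^+ q) ^+ (q ^ m) = x ^+ (q ^ m.+1).
Proof. by rewrite -exprM expnS. Qed.

Lemma frob_comp a b (x : K) : (x ^+ (q ^ a)) ^+ (q ^ b) = x ^+ (q ^ (a + b)).
Proof. by rewrite -exprM expnD. Qed.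

Lemma frob_sum m (I : Type) (r : seq I) (P : pred I) (f : I -> K) :
  (\sum_(i <- r | P i) f i) ^+ (q ^ m) = \sum_(i <- r | P i) f i ^+ (q ^ m).
Proof. exact: (big_morph _ (frobD m) (frob0 m)). Qed.

Lemma frob_scalar m (c : F) : io c ^+ (q ^ m) = io c.
Proof.
by rewrite -rmorphXn; elim: m => [|m IH] //; rewrite expnS exprM expf_card.
Qed.

Lemma frob_lin m (I : Type) (r : seq I) (c : I -> F) (x : I -> K) :
  (\sum_(i <- r) io (c i) * x i) ^+ (q ^ m)
    = \sum_(i <- r) io (c i) * x i ^+ (q ^ m).
Proof. by rewrite frob_sum; apply: eq_bigr => i _; rewrite exprMn frob_scalar. Qed.

(** For exponent 0 the sum is [q], which is 0 in [F]. Otherwise multiplication by a nonzero [y]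
    permutes [F], so the sum is unchanged when multiplied by a power of [y]; choosing that power
    different from 1 forces it to vanish. *)
Lemma sum_powers_eq0 j : (j < q.-1)%N -> \sum_(x : F) x ^+ j = 0.
Proof.
case: j => [_|j ltjq].
  have [p p_pr pF] := finPcharP F.
  rewrite (eq_bigr (fun=> 1)) ?sumr_const ?cardT; last by move=> x _; rewrite expr0.
  apply/eqP; rewrite -cardE -(dvdn_pcharf pF).
  have := q_gt1; rewrite (card_pprimeChar pF).
  by case: (logn _ _) => // m _; rewrite expnS dvdn_mulr.
have [y yj y0] : exists2 y : F, y ^+ j.+1 != 1 & y != 0.
  case: (pickP (fun y : F => (y != 0) && (y ^+ j.+1 != 1))) => [y /andP[y0 yj]|H].
    by exists y.
  (* This polynomial has at most [j.+1 < q - 1] roots, too few for all nonzero elements of [F]. *)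
  have p0 : ('X^(j.+1) - 1 : {poly F}) != 0 by rewrite -size_poly_eq0 size_XnsubC.
  have := max_poly_roots p0 (rs := [seq x <- enum F | x != 0]).
  rewrite size_XnsubC // filter_uniq ?enum_uniq // ltnS leqNgt.
  have -> : size [seq x <- enum F | x != 0] = q.-1.
    by rewrite -(cardC1 (0 : F)) cardE {2}/enum_mem -enumT; congr size; apply: eq_filter.
  rewrite ltjq => Hc; suff: ~~ true by []; apply: Hc => //; apply/allP => x; rewrite mem_filter => /andP[x0 _].
  by rewrite rootE !hornerE subr_eq0; have := H x; rewrite x0 /= => /negbFE.
set s := \sum_x _.
have : y ^+ j.+1 * s = s.
  rewrite /s mulr_sumr [RHS](reindex (fun x => y * x)) /=.
    by apply: eq_bigr => x _; rewrite exprMn.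
  by exists (fun x => y^-1 * x) => x _; rewrite ?mulKf ?mulVKf.
move/eqP; rewrite -subr_eq0 -{2}[s]mul1r -mulrBl mulf_eq0 subr_eq0 (negbTE yj).
by move/eqP.
Qed.

(* As in Chevalley-Warning: every monomial in the expansion of the product has
   degree less than [q - 1] in some coordinate. *)
Lemma sum_prod_forms_eq0 d (gs : seq ('I_d -> K)) : (size gs < q.-1 * d)%N ->
  \sum_(c : {ffun 'I_d -> F}) \prod_(g <- gs) \sum_s io (c s) * g s = 0.
Proof.
move=> ltgs; set m := size gs.
pose g (t : 'I_m) := tnth (in_tuple gs) t.
(* Expand over functions [f] choosing one coordinate per form; the resulting monomial has degree
   [#|[pred t | f t == s]|] in [c s]. *)
under eq_bigr do rewrite big_tnth bigA_distr_bigA.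
rewrite exchange_big big1 //= => f _.
transitivity (\sum_(c : {ffun 'I_d -> F})
   (\prod_(s < d) io (c s ^+ #|[pred t | f t == s]|)) * \prod_(t < m) g t (f t)).
  apply: eq_bigr => c _; rewrite big_split /=; congr (_ * _).
  rewrite (partition_big f xpredT) //=; apply: eq_bigr => s _.
  rewrite (eq_bigr (fun=> io (c s))) ?prodr_const ?rmorphXn //.
  by move=> t /eqP->.
rewrite -mulr_suml
  -(bigA_distr_bigA (fun s x => io (x ^+ #|[pred t | f t == s]|))) /=.
suff [s Hs] : exists s : 'I_d, (#|[pred t | f t == s]| < q.-1)%N.
  by rewrite (bigD1 s) //= -rmorph_sum sum_powers_eq0 // rmorph0 !mul0r.
apply/existsP; apply: contraT; rewrite negb_exists => /forallP H.
have : (q.-1 * d <= m)%N.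
  have -> : m = (\sum_(t < m) 1)%N by rewrite sum1_card card_ord.
  have -> : (q.-1 * d = \sum_(s < d) q.-1)%N by rewrite sum_nat_const card_ord mulnC.
  rewrite [X in (_ <= X)%N](partition_big f xpredT) //=; apply: leq_sum => s _.
  by rewrite sum1_card leqNgt; apply: H.
by rewrite leqNgt ltgs.
Qed.

(** A q-polynomial with [k] coefficients has size at most [q ^ k], so [q ^ k] distinct roots kill
    it. The exponents [q ^ j] are distinct, so each [d j] is one of its coefficients. *)
Lemma linearized_eq0 k (d : nat -> K) (rs : seq K) :
  uniq rs -> (q ^ k <= size rs)%N ->
  (forall x, x \in rs -> \sum_(j < k) d j * x ^+ (q ^ j) = 0) ->
  forall j, (j < k)%N -> d j = 0.
Proof.
move=> Urs le_rs rs0 j ltjk.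
pose P : {poly K} := \sum_(i < k) d i *: 'X^(q ^ i).
have P0 : P = 0.
  apply: (contraTeq _ le_rs) => nzP; rewrite -ltnNge.
  have szP : (size P <= q ^ k)%N.
    apply: leq_trans (size_sum _ _ _) _; apply/bigmax_leqP => i _.
    apply: leq_trans (size_scale_leq _ _) _.
    by rewrite size_polyXn ltn_exp2l // q_gt1.
  apply: leq_trans szP; apply: max_poly_roots => //; apply/allP => x /rs0 Hx.
  rewrite rootE horner_sum -[X in _ == X]Hx; apply/eqP; apply: eq_bigr => i _.
  by rewrite hornerZ hornerXn.
have := congr1 (fun p : {poly K} => p`_(q ^ j)) P0.
rewrite coef0 coef_sum (bigD1 (Ordinal ltjk)) //= big1 => [|i ne_ij].
  by rewrite coefZ coefXn eqxx mulr1 addr0.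
rewrite coefZ coefXn eqn_exp2l ?q_gt1 //.
by rewrite eq_sym -(inj_eq val_inj) /= in ne_ij *; rewrite (negbTE ne_ij) mulr0.
Qed.

Lemma q_predK : q.-1.+1 = q.
Proof. by rewrite prednK // ltnW // q_gt1. Qed.

(** Dividing by [t] reduces this to the factorization of [X^q - X] over [F]. *)
Lemma prod_line (x t : K) : t != 0 ->
  \prod_(a : F) (x + io a * t) = x ^+ q - t ^+ q.-1 * x.
Proof.
move=> t0.
have genP (y : K) : \prod_(a : F) (y + io a) = y ^+ q - y.
  have := congr1 (fun p => (map_poly io p).[y]) (finField_genPoly F).
  rewrite rmorphB /= map_polyXn map_polyX !hornerE rmorph_prod /= horner_prod => ->.
  rewrite (reindex_inj oppr_inj) /=; apply: eq_bigr => a _.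
  by rewrite rmorphN rmorphB /= map_polyX map_polyC !hornerE.
rewrite (eq_bigr (fun a => (x / t + io a) * t)); last first.
  by move=> a _; rewrite mulrDl divfK.
rewrite big_split /= genP prodr_const mulrBl -exprMn divfK //; congr (_ - _).
have -> : t ^+ q = t * t ^+ q.-1 by rewrite -exprS q_predK.
by rewrite mulrA divfK // mulrC.
Qed.

End FrobeniusPowers.

(** * Determinants *)

Section Determinants.
Variable K : comNzRingType.

(** Multilinearity in the columns: [f] records the summand chosen in each column. *)
Lemma det_sum_cols N (T : finType) (x : 'I_N -> T -> K) (G : 'I_N -> 'I_N -> T -> K) :
  \det (\matrix_(i, j) \sum_c x j c * G i j c) =
  \sum_(f : {ffun 'I_N -> T}) (\prod_j x j (f j)) * \det (\matrix_(i, j) G i j (f j)).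
Proof.
rewrite -det_tr /determinant.
transitivity (\sum_(s : 'S_N) \sum_(f : {ffun 'I_N -> T})
   (-1) ^+ s * \prod_j (x j (f j) * G (s j) j (f j))).
  apply: eq_bigr => s _; rewrite -mulr_sumr.
  rewrite -(bigA_distr_bigA (fun j c => x j c * G (s j) j c)); congr (_ * _).
  by apply: eq_bigr => i _; rewrite !mxE.
rewrite exchange_big; apply: eq_bigr => f _ /=.
rewrite -[X in _ = _ * X]/(\det _) -det_tr mulr_sumr; apply: eq_bigr => s _.
rewrite big_split mulrCA; congr (_ * (_ * _)).
by apply: eq_bigr => i _; rewrite !mxE.
Qed.

(** A nonzero term of the expansion would map the [N - i0] rows from [i0] on injectively into the
    [N - i0 - 1] columns after [i0]. *)
Lemma det_zero_block N (A : 'M[K]_N) (i0 : 'I_N) :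
  (forall r c : 'I_N, (i0 <= r)%N -> (c <= i0)%N -> A r c = 0) -> \det A = 0.
Proof.
move=> A0; apply: big1 => s _.
suff /existsP[r /andP[ler lec]] : [exists r : 'I_N, (i0 <= r)%N && (s r <= i0)%N].
  by rewrite (bigD1 r) //= A0 // mul0r mulr0.
apply: contraT; rewrite negb_exists => /forallP H.
pose D := [set r : 'I_N | (i0 <= r)%N].
have sub : s @: D \subset D :\ i0.
  apply/subsetP => x /imsetP[r]; rewrite inE => ler ->{x}; rewrite !inE.
  by have := H r; rewrite ler /= -ltnNge => lt; rewrite (ltnW lt) andbT -(inj_eq val_inj) /= gtn_eqF.
have := subset_leq_card sub; rewrite card_imset; last exact: perm_inj.
by rewrite (cardsD1 i0 D) inE leqnn ltnn.
Qed.

End Determinants.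

(** * Finite subspaces and their bases *)

Section Subspaces.
Variables (F : finFieldType) (n : nat).
Local Notation q := #|F|.
Local Notation S := (Spol F n).
Local Notation K := (Kf F n).
Implicit Types (W : {fset S}) (b : seq S) (c : nat -> F).

Definition scal : {rmorphism F -> K} := @tofrac S \o @mpolyC n F.

Lemma toK_lin (I : Type) (r : seq I) (c : I -> F) (x : I -> S) :
  toK (\sum_(i <- r) c i *: x i) = \sum_(i <- r) scal (c i) * toK (x i).
Proof.
rewrite /toK rmorph_sum; apply: eq_bigr => i _.
by rewrite -mul_mpolyC rmorphM.
Qed.

Lemma toK_inj : injective (@toK F n).
Proof. by move=> x y /eqP; rewrite /toK tofrac_eq => /eqP. Qed.

Lemma toK_eq0 (x : S) : (toK x == 0) = (x == 0).
Proof. exact: tofrac_eq0. Qed.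

Lemma is_subspaceP W : reflect
  (0 \in W /\ forall (a : F) u v, u \in W -> v \in W -> a *: u + v \in W)
  (is_subspace W).
Proof.
apply: (iffP andP) => -[W0 Wlin]; split=> //.
  move=> a u v uW vW.
  by move/forallP/(_ a)/forallP/(_ [` uW]%fset)/forallP/(_ [` vW]%fset): Wlin.
by apply/forallP => a; apply/forallP => u; apply/forallP => v; apply: Wlin; apply: fsvalP.
Qed.

Lemma subspaceZ W (a : F) u : is_subspace W -> u \in W -> a *: u \in W.
Proof.
by move=> /is_subspaceP[W0 Wlin] uW; have := Wlin a u 0 uW W0; rewrite addr0.
Qed.

Lemma subspace_sum W (I : Type) (r : seq I) (f : I -> S) :
  is_subspace W -> (forall i, f i \in W) -> \sum_(i <- r) f i \in W.
Proof.
move=> /is_subspaceP[W0 Wlin] fW; apply: (big_ind (fun x => x \in W)) => // x y xW yW.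
by have := Wlin 1 x y xW yW; rewrite scale1r.
Qed.

(** Coefficients are functions on [nat], so that [b] can grow or shrink without changing the type of
    [c]. *)
Definition lin b (c : nat -> F) : S := \sum_(i < size b) c i *: b`_i.

Lemma lin_cons w b c : lin (w :: b) c = c 0%N *: w + lin b (fun i => c i.+1).
Proof. by rewrite /lin /= big_ord_recl. Qed.

Lemma lin_rcons b w c : lin (rcons b w) c = lin b c + c (size b) *: w.
Proof.
rewrite /lin size_rcons big_ord_recr /= nth_rcons ltnn eqxx; congr (_ + _).
by apply: eq_bigr => i _; rewrite nth_rcons ltn_ord.
Qed.

Lemma eq_lin b c c' : (forall i, (i < size b)%N -> c i = c' i) -> lin b c = lin b c'.
Proof. by move=> Hc; apply: eq_bigr => i _; rewrite Hc. Qed.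

Lemma linB b c c' : lin b c - lin b c' = lin b (fun i => c i - c' i).
Proof.
by rewrite /lin -sumrB; apply: eq_bigr => i _; rewrite scalerBl.
Qed.

Definition lfree b := forall c, lin b c = 0 -> forall i, (i < size b)%N -> c i = 0.

Lemma lincomb_lin b (c : (size b).-tuple F) : lincomb c = lin b (nth 0 c).
Proof. by apply: eq_bigr => i _; rewrite (tnth_nth 0). Qed.

Lemma is_freeP b : reflect (lfree b) (is_free b).
Proof.
apply: (iffP forallP) => [H c c0 i lti | H c].
  have /implyP := H [tuple c j | j < size b].
  rewrite lincomb_lin (@eq_lin _ _ c) => [|j ltj]; last first.
    by rewrite -[j]/(val (Ordinal ltj)) -tnth_nth tnth_mktuple.
  rewrite c0 eqxx => /(_ isT)/eqP/(congr1 (fun t => tnth t (Ordinal lti))).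
  by rewrite tnth_mktuple (tnth_nth 0) nth_nseq lti.
apply/implyP => /eqP; rewrite lincomb_lin => c0; apply/eqP/eq_from_tnth => i.
by rewrite !(tnth_nth 0) nth_nseq ltn_ord H.
Qed.

Lemma is_basisP W b : reflect
  [/\ {subset b <= W}, lfree b & forall w, w \in W -> exists c, w = lin b c]
  (is_basis W b).
Proof.
apply: (iffP andP) => [[/andP[/allP sbW /is_freeP fb] /forallP span] | [sbW fb span]].
  split=> // w wW; have /existsP[c /eqP] := span [` wW]%fset.
  by rewrite /= lincomb_lin => ->; exists (nth 0 c).
split; first by apply/andP; split; [apply/allP | apply/is_freeP].
apply/forallP => w; have [c Hc] := span _ (fsvalP w); apply/existsP.
exists [tuple c j | j < size b]; rewrite lincomb_lin; apply/eqP.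
apply: (etrans Hc); apply: eq_lin => j ltj.
by rewrite -[j]/(val (Ordinal ltj)) -tnth_nth tnth_mktuple.
Qed.

Lemma lin_in W b c : is_subspace W -> {subset b <= W} -> lin b c \in W.
Proof.
move=> sW sbW; apply: subspace_sum => // i.
by apply: subspaceZ => //; apply/sbW/mem_nth.
Qed.

(** The same combinations over a finite type of coefficients, for counting and for sums over a
    subspace. *)
Definition flin b (c : {ffun 'I_(size b) -> F}) : S := \sum_i c i *: b`_i.

Definition coefs b (c : {ffun 'I_(size b) -> F}) (i : nat) : F := oapp c 0 (insub i).

Lemma coefsE b (c : {ffun 'I_(size b) -> F}) (i : 'I_(size b)) : coefs c i = c i.
Proof. by rewrite /coefs valK. Qed.

Lemma flinE b (c : {ffun 'I_(size b) -> F}) : flin c = lin b (coefs c).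
Proof. by apply: eq_bigr => i _; rewrite coefsE. Qed.

Lemma flin_inj b : lfree b -> injective (@flin b).
Proof.
move=> fb c c' /eqP; rewrite -subr_eq0 !flinE linB => /eqP/fb H.
by apply/ffunP => i; apply/eqP; rewrite -subr_eq0 -[c i]coefsE -[c' i]coefsE H.
Qed.

Lemma lfree_card W b : is_subspace W -> {subset b <= W} -> lfree b ->
  (q ^ size b <= #|` W|)%N.
Proof.
move=> sW sbW fb.
have <- : #|{ffun 'I_(size b) -> F}| = (q ^ size b)%N by rewrite card_ffun card_ord.
rewrite cardE -(size_map (@flin b)); apply: uniq_leq_size.
  by rewrite map_inj_uniq ?enum_uniq //; apply: flin_inj.
by move=> _ /mapP[c _ ->]; rewrite flinE; apply: lin_in.
Qed.

Lemma lfree_rcons b w : lfree b -> (forall c, w != lin b c) -> lfree (rcons b w).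
Proof.
move=> fb Hw c; rewrite lin_rcons => Hc.
have cw0 : c (size b) = 0.
  apply: contraTeq (Hw (fun i => - (c (size b))^-1 * c i)) => nzc; rewrite negbK.
  rewrite /lin; under eq_bigr do rewrite -scalerA.
  rewrite -scaler_sumr -/(lin b c) (eqP (_ : lin b c == - (c (size b) *: w))).
    by rewrite scaleNr scalerN opprK scalerA mulVf // scale1r.
  by rewrite -addr_eq0 Hc.
rewrite cw0 scale0r addr0 in Hc => i; rewrite size_rcons ltnS leq_eqVlt.
by case/predU1P=> [->|/(fb _ Hc)].
Qed.

(** Append vectors outside the span one at a time. This stops because a free family has fewer
    members than [W] has elements, by [lfree_card]. *)
Lemma extend_basis W b : is_subspace W -> {subset b <= W} -> lfree b ->
  exists b', is_basis W (b ++ b').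
Proof.
move=> sW; have [m] := ubnP (#|` W| - size b); elim: m b => // m IH b ltm sbW fb.
have ltb : (size b < #|` W|)%N.
  exact: leq_trans (ltn_expl _ (q_gt1 F)) (lfree_card sW sbW fb).
have [sp | ] := boolP [forall w : W, [exists c, val w == @flin b c]].
  exists [::]; rewrite cats0; apply/is_basisP; split=> // w wW.
  by have /forallP/(_ [` wW]%fset)/existsP[c /eqP/= ->] := sp; exists (coefs c); rewrite flinE.
rewrite negb_forall => /existsP[w]; rewrite negb_exists => /forallP Hw.
have [||| b' Hb'] := IH (rcons b (val w)).
- by rewrite size_rcons subnS -ltnS prednK // subn_gt0.
- by move=> x; rewrite mem_rcons in_cons => /predU1P[->|/sbW//]; apply: fsvalP.
- apply: lfree_rcons => // c; have := Hw [ffun i => c (val i)].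
  apply: contra => /eqP->; apply/eqP; rewrite flinE; apply: eq_lin => i lti.
  by rewrite -[i]/(val (Ordinal lti)) coefsE ffunE.
by exists (val w :: b'); rewrite -cat_rcons.
Qed.

Lemma sbasis_basis W : is_subspace W -> is_basis W (sbasis W).
Proof.
move=> sW; apply: (@ClassicalEpsilon.epsilon_spec _ (inhabits [::]) (fun b => is_basis W b)).
by have [||b Hb] := @extend_basis W [::] sW; [by [] | by move=> ? ? [] | exists b].
Qed.

Lemma basis_perm W b : is_subspace W -> is_basis W b ->
  perm_eq (enum_fset W) [seq flin c | c : {ffun 'I_(size b) -> F}].
Proof.
move=> sW /is_basisP[sbW fb sp]; apply: uniq_perm.
- exact: fset_uniq.
- by rewrite map_inj_uniq ?enum_uniq //; apply: flin_inj.
move=> w; apply/idP/mapP => [/sp[c ->]|[c _ ->]]; last by rewrite flinE lin_in.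
exists [ffun i => c (val i)]; rewrite ?mem_enum // flinE; apply: eq_lin => i lti.
by rewrite -[i]/(val (Ordinal lti)) coefsE ffunE.
Qed.

Lemma basis_card W b : is_subspace W -> is_basis W b -> #|` W| = (q ^ size b)%N.
Proof.
move=> sW bW; rewrite (perm_size (basis_perm sW bW)) size_map -cardE card_ffun.
by rewrite card_ord.
Qed.

(** Every basis has length the base-[q] logarithm of the number of vectors, so [sdim] does not
    depend on the basis chosen by [epsilon]. *)
Lemma basis_size W b : is_subspace W -> is_basis W b -> size b = sdim W.
Proof.
move=> sW bW; apply/eqP; rewrite -(eqn_exp2l _ _ (q_gt1 F)).
by rewrite -(basis_card sW bW) -(basis_card sW (sbasis_basis sW)).
Qed.

Lemma card_subspace W : is_subspace W -> #|` W| = (q ^ sdim W)%N.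
Proof. by move=> sW; apply: basis_card (sbasis_basis sW). Qed.

End Subspaces.

(** * Moore determinants and linearized relations *)

Section Moore.
Variables (F : finFieldType) (n : nat).
Local Notation q := #|F|.
Local Notation S := (Spol F n).
Local Notation K := (Kf F n).
Local Notation io := (scal F n).
Implicit Types (W : {fset S}) (b : seq S) (c : nat -> F).

Lemma eq_Adet b alpha beta : (forall j, (j < size b)%N -> alpha j = beta j) ->
  Adet b alpha = Adet b beta.
Proof.
by move=> H; congr (\det _); apply/matrixP => i j; rewrite !mxE H.
Qed.

Lemma toK_frob_lin m b c :
  toK (lin b c) ^+ (q ^ m) = \sum_(i < size b) io (c i) * toK b`_i ^+ (q ^ m).
Proof. by rewrite toK_lin (frob_lin io). Qed.

Lemma subspace_linearized_eq0 W (d : nat -> K) : is_subspace W ->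
  (forall w, w \in W -> \sum_(j < sdim W) d j * toK w ^+ (q ^ j) = 0) ->
  forall j, (j < sdim W)%N -> d j = 0.
Proof.
move=> sW Hd; apply: (@linearized_eq0 F _ _ _ [seq toK w | w <- enum_fset W]).
- by rewrite map_inj_uniq ?fset_uniq //; apply: toK_inj.
- by rewrite size_map -(card_subspace sW).
- by move=> _ /mapP[w wW ->]; apply: Hd.
Qed.

(** A linear dependence between the columns gives a q-polynomial with [dim W] coefficients that
    vanishes on the basis, hence on all of [W], so it is zero. *)
Lemma Moore_neq0 W b : is_subspace W -> is_basis W b ->
  Adet b (fun j => size b - 1 - j)%N != 0.
Proof.
move=> sW bW; have Hk := basis_size sW bW; have /is_basisP[sbW fb sp] := bW.
rewrite /Adet -det_tr; apply/det0P => -[v nzv vM].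
(* The order is reversed because the columns of the Moore matrix carry decreasing Frobenius
   exponents. *)
pose d s : K := oapp (fun j => v 0 (rev_ord j)) 0 (insub s : option 'I_(size b)).
have dE (j : 'I_(size b)) : d j = v 0 (rev_ord j) by rewrite /d valK.
have d0 j : (j < size b)%N -> d j = 0.
  rewrite {1}Hk => ltj; apply: (subspace_linearized_eq0 sW _ ltj) => w /sp[c ->].
  rewrite -Hk; under eq_bigr do rewrite toK_frob_lin mulr_sumr.
  rewrite exchange_big big1 //= => i _.
  transitivity (io (c i) * \sum_(j < size b) d j * toK b`_i ^+ (q ^ j)).
    by rewrite mulr_sumr; apply: eq_bigr => j' _; rewrite mulrCA.
  have := congr1 (fun M : 'rV_(size b) => M 0 i) vM; rewrite !mxE => vM0.
  rewrite (reindex_inj rev_ord_inj) -[RHS](mulr0 (io (c i))) -[in RHS]vM0.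
  congr (_ * _); apply: eq_bigr => j' _; rewrite dE rev_ordK !mxE /=.
  by congr (_ * _ ^+ (_ ^ _)%N); lia.
case/eqP: nzv; apply/rowP => j; rewrite mxE -[j]rev_ordK -dE.
exact: d0.
Qed.

(** Put the row of [w] on top of the rows of [b]: the rows are dependent, and the vanishing
    determinant is expanded along the new row. [bump j] skips the deleted column. *)
Lemma Adet_relation W b w (beta : nat -> nat) : is_basis W b -> w \in W ->
  \sum_(j < (size b).+1) (-1) ^+ j * toK w ^+ (q ^ beta j)
     * Adet b (fun i => beta (bump j i)) = 0.
Proof.
move=> /is_basisP[_ _ sp] /sp[c Hw].
pose A := \matrix_(i < (size b).+1, j < (size b).+1)
  (toK (w :: b)`_i ^+ (q ^ beta j) : K).
have detA : \det A = 0.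
  apply/eqP/det0P.
  exists (\row_i (if i == 0 :> nat then 1 else - io (c i.-1))).
    by apply/eqP => /rowP/(_ 0); rewrite !mxE /= => /eqP; rewrite oner_eq0.
  apply/rowP => j; rewrite !mxE big_ord_recl !mxE /= mul1r.
  rewrite Hw toK_frob_lin -big_split big1 //= => i _.
  by rewrite !mxE /= mulNr subrr.
rewrite -[RHS]detA (expand_det_row A ord0); apply: eq_bigr => j _.
rewrite /cofactor !mxE /= mulrA add0n; congr (_ * _); first by rewrite mulrC.
by congr (\det _); apply/matrixP => i j'; rewrite !mxE.
Qed.

Lemma Efun0 W : is_subspace W -> Efun W 0%N = 1.
Proof.
move=> sW; rewrite /Efun leq0n; case: eqP => // _.
rewrite /Defs.Schur /= (@eq_Adet (sbasis W) _ (fun j => size (sbasis W) - 1 - j)%N) //.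
by rewrite divff // (Moore_neq0 sW (sbasis_basis sW)).
Qed.

Lemma Efun_gt W (m : nat) : (sdim W < m)%N -> Efun W m = 0.
Proof. by rewrite ltnNge /Efun => /negbTE ->. Qed.

Lemma EfunE W (m : nat) : is_subspace W -> (m <= sdim W)%N ->
  Efun W m = Defs.Schur W (fun j => (j < m)%N : nat).
Proof.
move=> sW lem; have := Efun0 sW; rewrite /Efun lem.
case: eqP => // W0 _; rewrite /Defs.Schur.
set D := Adet _ _; set D' := Adet _ _; have -> : D = D'.
  by apply: eq_Adet; rewrite -/(sdim W) W0.
by rewrite divff // (Moore_neq0 sW (sbasis_basis sW)).
Qed.

(** With exponents [k, k-1, ..., 0], where [k] is the dimension, deleting the one at position [j]
    leaves the staircase plus the column partition [(1^j)]. *)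
Lemma Efun_relation W w : is_subspace W -> w \in W ->
  \sum_(j < (sdim W).+1) (-1) ^+ j * Efun W j * toK w ^+ (q ^ (sdim W - j)) = 0.
Proof.
move=> sW wW; have bW := sbasis_basis sW.
have := congr1 (fun x => x / Adet (sbasis W) (fun j => size (sbasis W) - 1 - j)%N)
   (Adet_relation (fun j => sdim W - j)%N bW wW).
rewrite mul0r mulr_suml => H; rewrite -[RHS]H; apply: eq_bigr => j _.
rewrite EfunE -1?ltnS // /Defs.Schur /= mulrAC mulrA; congr (_ * _ / _).
by apply: eq_Adet => i; rewrite /bump /sdim; lia.
Qed.

Lemma HfunE W (m : nat) : is_subspace W -> (0 < sdim W)%N ->
  Hfun W m = Defs.Schur W (fun j => if j == 0%N then m else 0%N).
Proof. by move=> sW; rewrite /Hfun; case: eqP => // ->. Qed.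

Lemma Hfun0 W : is_subspace W -> Hfun W 0%N = 1.
Proof.
move=> sW; rewrite /Hfun; case: eqP => // _.
rewrite /Defs.Schur /= (@eq_Adet (sbasis W) _ (fun j => size (sbasis W) - 1 - j)%N).
  by rewrite divff // (Moore_neq0 sW (sbasis_basis sW)).
by move=> j _; case: eqP.
Qed.

(** On [W], the power [q ^ (m + k)] reduces to powers up to [q ^ k], and [Hfun W m] is the leading
    coefficient of the reduction. *)
Lemma Hfun_relation W (m k : nat) : is_subspace W -> sdim W = k.+1 ->
  exists d : nat -> K, forall w, w \in W ->
    toK w ^+ (q ^ (m + k)) = Hfun W m * toK w ^+ (q ^ k)
      + \sum_(j < k) d j * toK w ^+ (q ^ j).
Proof.
move=> sW dW; have bW := sbasis_basis sW; have D0 := Moore_neq0 sW bW.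
set b := sbasis W in bW D0 *; have szb : size b = k.+1 by rewrite -dW.
set D := Adet _ _ in D0.
(* The exponents are [m + k, k, k-1, ..., 0]. Deleting the first gives the Moore determinant [D],
   deleting the second gives [A1]. *)
pose beta j := (if j == 0 then m + k else k.+1 - j)%N.
pose A1 := Adet b (fun j => (if j == 0 then m else 0) + (size b - 1 - j))%N.
have -> : Hfun W m = A1 / D by rewrite HfunE ?dW.
(* The exponent [j] sits at position [k + 1 - j], written here as [(k - j.+1).+2]. *)
exists (fun j => - ((-1) ^+ (k - j.+1)%N * Adet b (fun i => beta (bump (k - j.+1).+2 i)) / D)).
move=> w wW; have := Adet_relation beta bW wW.
rewrite szb !big_ord_recl /= !expr0 !mul1r expr1.
rewrite (@eq_Adet b _ (fun j => size b - 1 - j)%N); last first.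
  by move=> j _; rewrite /beta /bump /= szb; lia.
rewrite -/D (@eq_Adet b (fun i => beta (bump 1 i)) (fun j => (if j == 0 then m else 0) + (size b - 1 - j))%N); last first.
  by move=> [|j] _; rewrite /beta /bump /= szb; lia.
rewrite {1}/beta /= {1}/beta /= subSS subn0.
rewrite -/A1 => H; apply: (mulIf D0); move: H.
rewrite addrA mulN1r mulNr => /eqP; rewrite addr_eq0 => /eqP H.
rewrite -[LHS](subrK (toK w ^+ (q ^ k) * A1)) H mulrDl addrC; congr (_ + _).
  by rewrite mulrAC divfK // mulrC.
rewrite -sumrN mulr_suml (reindex_inj rev_ord_inj) /=; apply: eq_bigr => i _.
have -> : beta (bump 0 (bump 0 (k - i.+1))) = i.
  by rewrite /beta /bump /=; have := ltn_ord i; lia.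
rewrite /bump /= !add1n !exprS !mulN1r opprK.
by rewrite !mulNr [X in - (X * D)]mulrAC divfK // mulrAC.
Qed.

End Moore.

(** * The quotient by a line *)

#[local] Arguments Efun : simpl never.
#[local] Arguments Hfun : simpl never.

Section RingIdentities.
Variable R : comNzRingType.
Implicit Types s e f g u x y z w : R.

Lemma fL_linear_identity c u v x y a : (c * x + y) - a * (c * u + v) =
  c * (x - a * u) + (y - a * v) :> R.
Proof. ring. Qed.

Lemma Efun_identity s e f g u w :
  -1 * s * (e - f - u * g) * w = -1 * s * e * w - -1 * s * f * w + s * (u * g) * w.
Proof. ring. Qed.

Lemma Efun_frob_identity s e u x y : s * e * x - s * (u * e) * y = s * e * (x - u * y).
Proof. ring. Qed.

Lemma Efun_sum_identity x y z : y - z + (x + z) = x + y.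
Proof. ring. Qed.

Lemma Hfun_term_identity e u x y : e * (x - u * y) = e * x + - (e * u) * y.
Proof. ring. Qed.

Lemma Hfun_lead_identity e u x y z : - e * u * y + z = e * (x - u * y) + z - e * x.
Proof. ring. Qed.

Lemma Hfun_identity f g h u x y z :
  -1 * (x - u * y - f * z) + (x - g * z + - u * (y - h * z)) = (f - (g - u * h)) * z.
Proof. ring. Qed.

End RingIdentities.

Section Quotient.
Variables (F : finFieldType) (n : nat).
Local Notation q := #|F|.
Local Notation S := (Spol F n).
Local Notation K := (Kf F n).
Local Notation io := (scal F n).
Implicit Types (W V L : {fset S}) (b : seq S).

Lemma toKZ (a : F) (x : S) : toK (a *: x) = io a * toK x.
Proof. by rewrite /toK -mul_mpolyC rmorphM. Qed.

Lemma toKD (x y : S) : toK (x + y) = toK x + toK y.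
Proof. exact: rmorphD. Qed.

Lemma lfree1 (l : S) : l != 0 -> lfree [:: l].
Proof.
move=> l0 c; rewrite lin_cons /lin big_ord0 addr0 => Hc [|//] _; apply/eqP.
have : toK (c 0%N *: l) == 0 by rewrite toK_eq0 Hc.
rewrite toKZ mulf_eq0 => /orP[|]; first by rewrite fmorph_eq0.
by rewrite toK_eq0 => l0'; case/negP: l0.
Qed.

Lemma line_basis L l : is_subspace L -> sdim L = 1%N -> l \in L -> l != 0 ->
  is_basis L [:: l].
Proof.
move=> sL dL lL l0.
have [|b bL] := extend_basis sL _ (lfree1 l0).
  by move=> x; rewrite inE => /eqP ->.
have := basis_size sL bL; rewrite size_cat dL => -[/size0nil b0].
by rewrite b0 cats0 in bL.
Qed.

Lemma line_memP L l : is_subspace L -> sdim L = 1%N -> l \in L -> l != 0 ->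
  forall x, reflect (exists a : F, x = a *: l) (x \in L).
Proof.
move=> sL dL lL l0 x; apply: (iffP idP) => [xL|[a ->]]; last exact: subspaceZ.
have /is_basisP[_ _ sp] := line_basis sL dL lL l0.
by have [c ->] := sp x xL; exists (c 0%N); rewrite lin_cons /lin big_ord0 addr0.
Qed.

Section Line.
Variables (L : {fset S}) (l : S).
Hypotheses (sL : is_subspace L) (dL : sdim L = 1%N) (lL : l \in L) (l0 : l != 0).
Local Notation a := (toK l ^+ q.-1).

Lemma scaler_line_inj : injective (fun x : F => x *: l).
Proof.
move=> x y /(congr1 (@toK F n)); rewrite /= !toKZ => /mulIf H.
by apply/(fmorph_inj io)/H; rewrite toK_eq0.
Qed.

(** [L] consists of the [F]-multiples of [l], so the product defining [fL] is the one in
    [prod_line]. *)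
Lemma toK_fL (x : S) : toK (fL L x) = toK x ^+ q - a * toK x.
Proof.
have pL : perm_eq (enum_fset L) [seq c *: l | c : F].
  apply: uniq_perm; first exact: fset_uniq.
    by rewrite map_inj_uniq ?enum_uniq //; apply: scaler_line_inj.
  move=> u; apply/(line_memP sL dL lL l0)/mapP => -[c]; last by exists c.
  by move=> ->; exists c; rewrite ?mem_enum.
rewrite -(prod_line io) ?toK_eq0 // /fL (perm_big _ pL) big_map big_enum /toK rmorph_prod.
by apply: eq_bigr => c _; rewrite -toKZ -toKD.
Qed.

Lemma fL_linear (c : F) u v : fL L (c *: u + v) = c *: fL L u + fL L v.
Proof.
apply: toK_inj; rewrite toKD toKZ !toK_fL toKD toKZ.
have := frobD io 1 (io c * toK u) (toK v); rewrite expn1 => ->.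
have := frob_scalar io 1 c; rewrite expn1 exprMn => ->.
exact: fL_linear_identity.
Qed.

Lemma fL0 : fL L 0 = 0.
Proof.
apply: toK_inj; rewrite toK_fL /toK tofrac0 mulr0 subr0 expr0n.
by rewrite -(q_predK F).
Qed.

Lemma fL_lin b c : fL L (lin b c) = lin (map (fL L) b) c.
Proof.
elim: b c => [|w b IH] c; first by rewrite /lin !big_ord0 fL0.
by rewrite /= !lin_cons fL_linear IH.
Qed.

Lemma fL_eq0 x : (fL L x == 0) = (x \in L).
Proof.
rewrite /fL prodf_seq_eq0; apply/hasP/idP => [[u uL /=]|xL].
  by rewrite addr_eq0 => /eqP ->; rewrite -scaleN1r; apply: subspaceZ.
by exists (- x); rewrite /= ?addrN // -scaleN1r; apply: subspaceZ.
Qed.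

Section InSpace.
Variable V : {fset S}.
Hypotheses (sV : is_subspace V) (LV : fsubset L V).

Lemma quotP x : reflect (exists2 v, v \in V & x = fL L v) (x \in quot V L).
Proof. exact: imfsetP. Qed.

Lemma fL_quot v : v \in V -> fL L v \in quot V L.
Proof. by move=> vV; apply/quotP; exists v. Qed.

Lemma quot_subspace : is_subspace (quot V L).
Proof.
have /is_subspaceP[V0 Vlin] := sV; apply/is_subspaceP; split.
  by rewrite -fL0 fL_quot.
move=> c _ _ /quotP[u uV ->] /quotP[v vV ->]; rewrite -fL_linear fL_quot //.
exact: Vlin.
Qed.

(** Complete [l] to a basis of [V]; the images of the added vectors form a basis of the quotient. *)
Lemma sdim_quot : sdim V = (sdim (quot V L)).+1.
Proof.
have lV : l \in V by apply: (fsubsetP LV).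
have [|b bV] := extend_basis sV _ (lfree1 l0).
  by move=> x; rewrite inE => /eqP ->.
have /is_basisP[sbV fb sp] := bV.
have bQ : is_basis (quot V L) (map (fL L) b).
  apply/is_basisP; split.
  - move=> _ /mapP[x xb ->]; apply: fL_quot; apply: sbV.
    by rewrite inE xb orbT.
  - move=> c; rewrite -fL_lin => /eqP; rewrite fL_eq0.
    move=> /(line_memP sL dL lL l0)[e He] i; rewrite size_map => lti.
    (* A relation between the images puts a combination of [b] in [L]; subtracting that multiple of
       [l] gives a relation in [l :: b]. *)
    apply: (fb (fun j => if j is j'.+1 then c j' else - e) _ i.+1) => //.
    by rewrite lin_cons /= He scaleNr addNr.
  move=> _ /quotP[v /sp[c ->] ->]; exists (fun i => c i.+1).
  rewrite fL_lin /= lin_cons (_ : fL L l = 0) ?scaler0 ?add0r //.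
  by apply/eqP; rewrite fL_eq0.
by rewrite -(basis_size sV bV) -(basis_size quot_subspace bQ) size_map.
Qed.

(** Substituting [v^q - a v] into the relation of the quotient gives a monic relation on [V] of the
    same degree as that of [V] itself. Their difference has only [dim V] coefficients, so it is
    zero. *)
Lemma Efun_quot r : (r < sdim V)%N ->
  Efun V r.+1 = Efun (quot V L) r.+1
                + a ^+ (q ^ (sdim V - r.+1)) * Efun (quot V L) r.
Proof.
move=> ltr; have sQ := quot_subspace; set Q := quot V L in sQ *.
have [k dV] : exists k, sdim V = k.+1 by exists (sdim Q); exact: sdim_quot.
have dQ : sdim Q = k by have := sdim_quot; rewrite dV => -[].
pose D j := Efun V j.+1 - Efun Q j.+1 - a ^+ (q ^ (k - j)) * Efun Q j.
suff D0 : D r = 0.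
  rewrite dV in ltr *; move/eqP: D0; rewrite /D subr_eq0 subr_eq addrC => /eqP ->.
  by rewrite subSS.
(* [d s] is the coefficient of [v^(q^s)] in the difference of the two relations. *)
pose d s := (-1) ^+ (k - s).+1 * D (k - s)%N.
suff H : d (k - r)%N = 0.
  by move/eqP: H; rewrite /d subKn -1?ltnS -?dV // mulf_eq0 signr_eq0 => /eqP.
apply: (subspace_linearized_eq0 sV) => [v vV|]; last by rewrite dV ltnS leq_subr.
have HV := Efun_relation sV vV; have HQ := Efun_relation sQ (fL_quot vV).
rewrite dV big_ord_recl expr0 mul1r Efun0 // mul1r subn0 in HV.
(* The [v^q] part of the substituted relation: [HA] splits off its leading power, and [HB] equates
   it with the [a v] part. *)
have HA : \sum_(j < k.+1) (-1) ^+ j * Efun Q j * toK v ^+ (q ^ (k.+1 - j))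
  = toK v ^+ (q ^ k.+1)
    + \sum_(j < k.+1) (-1) ^+ j.+1 * Efun Q j.+1 * toK v ^+ (q ^ (k - j)).
  rewrite [in RHS]big_ord_recr /= Efun_gt ?dQ // mulr0 mul0r addr0.
  by rewrite big_ord_recl expr0 mul1r Efun0 // mul1r subn0.
have HB : \sum_(j < k.+1) (-1) ^+ j * Efun Q j * toK v ^+ (q ^ (k.+1 - j))
  = \sum_(j < k.+1) (-1) ^+ j * (a ^+ (q ^ (k - j)) * Efun Q j) * toK v ^+ (q ^ (k - j)).
  apply/eqP; rewrite -subr_eq0 -sumrB; apply/eqP; rewrite -[RHS]HQ dQ.
  apply: eq_bigr => j _; rewrite toK_fL (frobB io) frobS exprMn -subSn -1?ltnS //.
  exact: Efun_frob_identity.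
rewrite {}HA in HB; set SB := (X in _ = X) in HB; set SE := (X in _ + X) in HB.
set SV := (X in _ + X) in HV.
have HC : SV - SE + SB = 0 by rewrite -HB -[RHS]HV Efun_sum_identity.
rewrite dV (reindex_inj rev_ord_inj) -[RHS]HC /SV /SE /SB -sumrB -big_split.
apply: eq_bigr => j _; rewrite /= /d /D subSS subKn -1?ltnS //.
by rewrite /bump /= !add1n !exprS Efun_identity.
Qed.

(** Agreement on [V] with a q-polynomial in the powers below [q ^ k]; it serves to compute modulo
    lower Frobenius powers. *)
Definition lower k (f : S -> K) := exists d : nat -> K,
  forall v, v \in V -> f v = \sum_(j < k) d j * toK v ^+ (q ^ j).

Lemma lowerD k f g : lower k f -> lower k g -> lower k (fun v => f v + g v).
Proof.
move=> [d Hd] [e He]; exists (fun j => d j + e j) => v vV; rewrite Hd // He //.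
by rewrite -big_split; apply: eq_bigr => j _; rewrite mulrDl.
Qed.

Lemma lowerZ k x f : lower k f -> lower k (fun v => x * f v).
Proof.
move=> [d Hd]; exists (fun j => x * d j) => v vV; rewrite Hd // mulr_sumr.
by apply: eq_bigr => j _; rewrite mulrA.
Qed.

Lemma lower_frob k j : (j < k)%N -> lower k (fun v => toK v ^+ (q ^ j)).
Proof.
move=> ltj; exists (fun i => (i == j)%:R) => v _.
rewrite (bigD1 (Ordinal ltj)) //= eqxx mul1r big1 ?addr0 // => i.
by rewrite -(inj_eq val_inj) /= => /negbTE ->; rewrite mul0r.
Qed.

Lemma lower_sum k m (f : nat -> S -> K) : (forall j, (j < m)%N -> lower k (f j)) ->
  lower k (fun v => \sum_(j < m) f j v).
Proof.
elim: m => [|m IH] Hf.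
  exists (fun=> 0) => v _; rewrite big_ord0 big1 // => j _; exact: mul0r.
have [d Hd] := lowerD (IH (fun j ltj => Hf j (ltnW ltj))) (Hf m (ltnSn m)).
by exists d => v vV; rewrite big_ord_recr; apply: Hd.
Qed.

Lemma lower_eq k f g : (forall v, v \in V -> f v = g v) -> lower k f -> lower k g.
Proof. by move=> Hfg [d Hd]; exists d => v vV; rewrite -Hfg ?Hd. Qed.

Lemma lower_top k x : sdim V = k.+1 -> lower k (fun v => x * toK v ^+ (q ^ k)) -> x = 0.
Proof.
move=> dV [d Hd]; pose e j := if j == k then x else - d j.
have <- : e k = x by rewrite /e eqxx.
apply: (subspace_linearized_eq0 sV) => [v vV|]; last by rewrite dV.
rewrite dV big_ord_recr /= {2}/e eqxx Hd // -big_split big1 //= => j _.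
by rewrite /e ltn_eqF // mulNr addNr.
Qed.

(** Raise [f_L(v) = v^q - a v] to the power [q ^ (m + k)], with [k] the dimension of the quotient,
    and reduce both sides modulo powers below [q ^ k]: the coefficients of [v^(q^k)] must agree. *)
Lemma Hfun_quot (m : nat) :
  Hfun (quot V L) m.+1 = Hfun V m.+1
     - a ^+ (q ^ (m + sdim (quot V L))) * Hfun V m.
Proof.
have sQ := quot_subspace; set Q := quot V L in sQ *.
set k := sdim Q; have dV : sdim V = k.+1 := sdim_quot.
have [d1 H1] := Hfun_relation m.+1 sV dV; have [d0 H0] := Hfun_relation m sV dV.
have lQ : lower k (fun v => toK (fL L v) ^+ (q ^ (m + k))
                            - Hfun Q m.+1 * toK v ^+ (q ^ k)).
  (* If the quotient is zero, [f_L] vanishes on [V] and [Hfun Q m.+1] is 0 by convention. *)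
  case dQ : k => [|k'].
    exists (fun=> 0) => v vV; rewrite big_ord0 /Hfun -/k dQ mul0r subr0.
    have -> : toK (fL L v) = 0; last by rewrite frob0.
    have /eqP/cardfs1P[x Qx] : #|` Q| = 1%N by rewrite (card_subspace sQ) -/k dQ.
    have /is_subspaceP[Q0 _] := sQ; have := fL_quot vV.
    have mQ z : z \in Q -> z = x by rewrite Qx => /fset1P.
    by move=> /mQ ->; rewrite -(mQ _ Q0) /toK tofrac0.
  have [e He] := Hfun_relation m.+1 sQ dQ.
  apply: (lower_eq (f := fun v => (- Hfun Q m.+1 * a ^+ (q ^ k')) * toK v ^+ (q ^ k')
     + \sum_(j < k') (e j * toK v ^+ (q ^ j.+1) + (- (e j * a ^+ (q ^ j)) * toK v ^+ (q ^ j))))).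
    move=> v vV; rewrite addnS -addSn He ?fL_quot // toK_fL (frobB io) frobS exprMn.
    rewrite [in RHS](eq_bigr (fun j : 'I_k' => e j * toK v ^+ (q ^ j.+1)
       + (- (e j * a ^+ (q ^ j)) * toK v ^+ (q ^ j)))); last first.
      by move=> j _; rewrite (frobB io) frobS exprMn Hfun_term_identity.
    exact: Hfun_lead_identity.
  apply: lowerD; first exact/lowerZ/lower_frob.
  apply: (lower_sum (f := fun j v => e j * toK v ^+ (q ^ j.+1)
       + (- (e j * a ^+ (q ^ j)) * toK v ^+ (q ^ j)))) => j ltj.
  by apply: lowerD; apply: lowerZ; apply: lower_frob => //; apply: ltnW.
have l1 : lower k (fun v => toK v ^+ (q ^ (m.+1 + k)) - Hfun V m.+1 * toK v ^+ (q ^ k)).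
  by exists d1 => v vV; rewrite H1 // addrAC subrr add0r.
have l0' : lower k (fun v => toK v ^+ (q ^ (m + k)) - Hfun V m * toK v ^+ (q ^ k)).
  by exists d0 => v vV; rewrite H0 // addrAC subrr add0r.
apply/eqP; rewrite -subr_eq0; apply/eqP/(lower_top dV).
apply: (lower_eq _ (lowerD (lowerZ (-1) lQ)
   (lowerD l1 (lowerZ (- a ^+ (q ^ (m + k))) l0')))) => v vV.
by rewrite toK_fL (frobB io) frobS exprMn Hfun_identity.
Qed.

End InSpace.
End Line.
End Quotient.

(** * Sums over the lines of a subspace *)

Section LineSums.
Variables (F : finFieldType) (n : nat).
Local Notation q := #|F|.
Local Notation S := (Spol F n).
Local Notation K := (Kf F n).
Local Notation io := (scal F n).
Implicit Types (U W V L : {fset S}) (b : seq S).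

Lemma sum_const_fset W (x : K) : \sum_(w <- enum_fset W) x = x *+ #|` W|.
Proof. by rewrite big_const_seq count_predT iter_addr_0. Qed.

(** There are [q^dim - 1] nonzero vectors, and [q] is 0 in [K]. *)
Lemma sum_const_nonzero W (x : K) : is_subspace W -> (0 < sdim W)%N ->
  \sum_(w <- enum_fset W | w != 0) x = - x.
Proof.
move=> sW dW; have /is_subspaceP[W0 _] := sW.
have := sum_const_fset W x; rewrite (bigD1_seq 0) ?fset_uniq //=.
rewrite (card_subspace sW) -(prednK dW) expnS mulrnA -[x *+ q]mulr_natl (natr_q io) mul0r mul0rn.
by move=> /eqP; rewrite addrC addr_eq0 => /eqP.
Qed.

Definition line (l : S) : {fset S} := seq_fset tt [seq c *: l | c : F].

Lemma mem_line l x : reflect (exists c : F, x = c *: l) (x \in line l).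
Proof.
rewrite seq_fsetE; apply: (iffP mapP) => -[c]; first by move=> _ ->; exists c.
by move=> ->; exists c; rewrite ?mem_enum.
Qed.

Lemma line_self l : l \in line l.
Proof. by apply/mem_line; exists 1; rewrite scale1r. Qed.

Lemma line_subspace l : is_subspace (line l).
Proof.
apply/is_subspaceP; split; first by apply/mem_line; exists 0; rewrite scale0r.
move=> a _ _ /mem_line[c ->] /mem_line[d ->]; apply/mem_line.
by exists (a * c + d); rewrite scalerA scalerDl.
Qed.

Lemma sdim_line l : l != 0 -> sdim (line l) = 1%N.
Proof.
move=> l0; rewrite -(basis_size (b := [:: l]) (line_subspace l)) //.
apply/is_basisP; split; last 1 first.
- by move=> w /mem_line[c ->]; exists (fun=> c); rewrite lin_cons /lin big_ord0 addr0.
- by move=> x; rewrite inE => /eqP ->; apply: line_self.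
exact: lfree1.
Qed.

Lemma line_unique L l : is_subspace L -> sdim L = 1%N -> l \in L -> l != 0 ->
  L = line l.
Proof.
move=> sL dL lL l0; apply/fsetP => x.
by apply/(line_memP sL dL lL l0)/mem_line.
Qed.

(** Double counting of pairs of a line and a nonzero vector on it: each line occurs [q - 1] times,
    that is -1 times in [K]. *)
Lemma sum_lines_vectors U (g : {fset S} -> K) (f : S -> K) : is_subspace U ->
  (forall L l, is_subspace L -> sdim L = 1%N -> fsubset L U -> l \in L -> l != 0 ->
     g L = f l) ->
  \sum_(L <- fpowerset U | is_subspace L && (sdim L == 1%N)) g L
    = - \sum_(l <- enum_fset U | l != 0) f l.
Proof.
move=> sU gf.
have Hf l : l \in U -> l != 0 ->
    f l = \sum_(L <- fpowerset U | is_subspace L && (sdim L == 1%N))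
            (if l \in L then g L else 0).
  move=> lU l0; have lineU : fsubset (line l) U.
    by apply/fsubsetP => _ /mem_line[c ->]; apply: subspaceZ.
  rewrite big_mkcond (bigD1_seq (line l)) ?fset_uniq ?fpowersetE //=.
  rewrite line_subspace sdim_line // eqxx line_self big1 ?addr0 => [|L neL].
    by apply/esym/gf; rewrite ?line_subspace ?sdim_line ?line_self.
  case: ifP => // /andP[sL /eqP dL]; case: ifP => // lL.
  by rewrite (line_unique sL dL lL l0) eqxx in neL.
have -> : \sum_(l <- enum_fset U | l != 0) f l =
    \sum_(l <- enum_fset U | l != 0)
      \sum_(L <- fpowerset U | is_subspace L && (sdim L == 1%N))
         (if l \in L then g L else 0).
  by rewrite big_seq_cond [RHS]big_seq_cond; apply: eq_bigr => l /andP[lU l0]; apply: Hf.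
rewrite exchange_big -sumrN big_seq_cond [RHS]big_seq_cond.
apply: eq_bigr => L /andP[]; rewrite fpowersetE => LU /andP[sL /eqP dL].
rewrite -big_mkcondr /= -[g L in LHS]opprK; congr (- _).
have d0 : (0 < sdim L)%N by rewrite dL.
rewrite -(sum_const_nonzero (g L) sL d0).
rewrite -[LHS]big_filter -[RHS]big_filter; apply: perm_big; apply: uniq_perm; rewrite ?filter_uniq ?fset_uniq // => l.
rewrite !mem_filter; case: (l == 0) => //=.
by apply/idP/andP => [lL | [] //]; split=> //; apply: (fsubsetP LU).
Qed.

(** Writes powers as repeated factors, so that [sum_prod_forms_eq0] counts each linear form with its
    multiplicity. *)
Lemma prod_powers_flatten m (g : nat -> K) (es : seq nat) (T : Type) (h : nat -> T) (G : T -> K) :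
  (forall e, G (h e) = g e) ->
  \prod_(e <- es) g e ^+ m = \prod_(t <- flatten [seq nseq m (h e) | e <- es]) G t.
Proof.
move=> Gh; rewrite big_flatten big_map; apply: eq_bigr => e _.
by rewrite big_nseq Gh iter_mulr_1.
Qed.

Lemma size_flatten_nseq m (es : seq nat) (T : Type) (h : nat -> T) :
  size (flatten [seq nseq m (h e) | e <- es]) = (m * size es)%N.
Proof.
by elim: es => [|e es IH] /=; rewrite ?muln0 // size_cat size_nseq IH mulnS.
Qed.

(** In coordinates on [U], each [l^(q^e)] is a linear form, so the monomial is a product of
    [(q - 1) * size es] forms in [dim U] variables. *)
Lemma sum_line_monomial U (es : seq nat) : is_subspace U -> (size es < sdim U)%N ->
  \sum_(l <- enum_fset U | l != 0) \prod_(e <- es) (toK l ^+ q.-1) ^+ (q ^ e)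
    = if es == [::] then - 1 else 0.
Proof.
move=> sU; case: es => [|e es] lt_es.
  under eq_bigr do rewrite big_nil.
  exact: sum_const_nonzero.
have q1 : (0 < q.-1)%N by have := q_gt1 F; lia.
have /is_subspaceP[U0 _] := sU.
(* The vector 0 may be added to the sum because the product is nonempty and [q - 1 > 0]. *)
transitivity (\sum_(l <- enum_fset U) \prod_(e <- e :: es) (toK l ^+ q.-1) ^+ (q ^ e)).
  rewrite [RHS](bigD1_seq 0) ?fset_uniq //= big_cons /toK tofrac0.
  by rewrite expr0n gtn_eqF // frob0 mul0r add0r.
rewrite [RHS]/=; move: (e :: es) lt_es => {e}es lt_es.
have bU := sbasis_basis sU; set b := sbasis U in bU.
rewrite (perm_big _ (basis_perm sU bU)) big_map big_enum /=.
pose h e (s : 'I_(size b)) : K := toK b`_s ^+ (q ^ e).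
rewrite -[RHS](@sum_prod_forms_eq0 F K io _ (flatten [seq nseq q.-1 (h e) | e <- es])).
  apply: eq_bigr => c _.
  rewrite -(@prod_powers_flatten _ (fun e => toK (flin c) ^+ (q ^ e))).
    by apply: eq_bigr => e _; rewrite exprAC.
  by move=> e; rewrite toK_lin (frob_lin io).
by rewrite size_flatten_nseq ltn_mul2l q1.
Qed.

Lemma sum_line_polynomial U (I : finType) (coef : I -> K) (es : I -> seq nat) :
  is_subspace U -> (forall i, coef i != 0 -> (size (es i) < sdim U)%N) ->
  - \sum_(l <- enum_fset U | l != 0)
      \sum_i coef i * \prod_(e <- es i) (toK l ^+ q.-1) ^+ (q ^ e)
  = \sum_(i | es i == [::]) coef i.
Proof.
move=> sU bnd; rewrite exchange_big -sumrN [RHS]big_mkcond; apply: eq_bigr => i _ /=.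
rewrite -mulr_sumr; have [->|/bnd lt_es] := eqVneq (coef i) 0.
  by rewrite mul0r oppr0 if_same.
rewrite sum_line_monomial //; case: eqP => _; last by rewrite mulr0 oppr0.
by rewrite mulrN1 opprK.
Qed.

(** [shat_add] adds the root exponents, so the right side is the same element with a larger
    exponent; the induction compares them through [shat_eq]. *)
Lemma shat_eq_sum_lines U N (x : K) (g : {fset S} -> K) :
  x = \sum_(L <- fpowerset U | is_subspace L && (sdim L == 1%N)) g L ->
  shat_eq ((N, x) : Shat F n) (sum_lines U (fun L => (N, g L))).
Proof.
move=> ->; rewrite /sum_lines.
elim: (enum_fset _) => [|L r IH]; rewrite ?big_nil ?big_cons.
  by rewrite /shat_eq /qq [LHS]frob0 [RHS]frob0.
case: ifP => // _; move: IH; set y := \big[_/_]_(_ <- _ | _) _; case: y => m y.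
rewrite /shat_eq /shat_add /= /qq => H.
by rewrite -H -(frobD io) frob_comp addnC.
Qed.

Lemma sum_lines_polynomial U N (g : {fset S} -> K) (x : K)
  (I : finType) (coef : I -> K) (es : I -> seq nat) :
  is_subspace U -> (forall i, coef i != 0 -> (size (es i) < sdim U)%N) ->
  (forall L l, is_subspace L -> sdim L = 1%N -> fsubset L U -> l \in L -> l != 0 ->
     g L = \sum_i coef i * \prod_(e <- es i) (toK l ^+ q.-1) ^+ (q ^ e)) ->
  x = \sum_(i | es i == [::]) coef i ->
  shat_eq ((N, x) : Shat F n) (sum_lines U (fun L => (N, g L))).
Proof.
move=> sU bnd gE ->; apply: shat_eq_sum_lines.
by rewrite (sum_lines_vectors sU gE) sum_line_polynomial.
Qed.

End LineSums.

(** * Partitions *)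

Section Partitions.
Local Open Scope nat_scope.
Implicit Types (l m : seq nat) (c i j N : nat).

Lemma part_le l i j : is_partition l -> i <= j -> part l j <= part l i.
Proof.
move=> Pl le_ij; have [ltj|gej] := ltnP j (size l); last by rewrite /part nth_default.
have geq_trans : transitive geq by move=> x y z /= h1 h2; apply: leq_trans h2 h1.
apply: (sorted_leq_nth geq_trans _ 0 Pl) => //; first by move=> x /=.
by rewrite inE (leq_ltn_trans le_ij).
Qed.

Lemma conjp_le l j c : is_partition l -> part l j < c -> conjp l c <= j.
Proof.
move=> Pl ltc; rewrite /conjp -[l](cat_take_drop j) count_cat.
rewrite [X in _ + X](_ : _ = 0) ?addn0.
  by rewrite (leq_trans (count_size _ _)) // size_take_min geq_minl.
apply/eqP; rewrite -leqn0 leqNgt -has_count; apply/negP => /(has_nthP 0)[i lti].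
rewrite nth_drop => lec; have := part_le Pl (leq_addr i j).
by rewrite /part leqNgt (leq_trans _ lec).
Qed.

Lemma conjp_gt l j c : is_partition l -> 0 < c -> c <= part l j -> j < conjp l c.
Proof.
move=> Pl c0 lec.
have ltj : j < size l.
  (* Past the end of the list [part] is 0, which [0 < c] excludes. *)
  by rewrite ltnNge; apply/negP => gej; move: lec; rewrite /part nth_default //; lia.
rewrite /conjp -[l](cat_take_drop j.+1) count_cat.
have /eqP -> : count (leq c) (take j.+1 l) == size (take j.+1 l).
  rewrite -all_count; apply/(all_nthP 0) => i; rewrite size_takel // => lti.
  by rewrite nth_take // (leq_trans lec) //; apply: part_le.
by rewrite size_takel // leq_addr.
Qed.

Lemma count_interval a b M : a <= b <= M ->
  count (fun c => a < c <= b) (iota 1 M) = b - a.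
Proof.
move=> /andP[le_ab le_bM]; have -> : M = a + ((b - a) + (M - b)) by lia.
rewrite iotaD count_cat iotaD count_cat.
have cz s : (forall c, c \in s -> ~~ (a < c <= b)) -> count (fun c => a < c <= b) s = 0.
  move=> H; apply/eqP; rewrite -leqn0 leqNgt -has_count -all_predC.
  by apply/allP => c /H.
rewrite cz => [|c]; last by rewrite mem_iota; lia.
rewrite [X in _ + (_ + X)]cz => [|c]; last by rewrite mem_iota; lia.
rewrite add0n addn0; apply/eqP; rewrite -[X in _ == X](size_iota (1 + a)) -all_count.
by apply/allP => c; rewrite mem_iota; lia.
Qed.

(** Count cells by columns: the intervals [(mu_j, nu_j]] are disjoint, so a column [c] meets at most
    one of them, and if it meets one then [conjp mu c < conjp lam c]. *)
Lemma horizontal_strip_size lam mu N (nu : nat -> nat) :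
  is_partition lam -> is_partition mu ->
  (forall j, j < N -> part mu j <= nu j <= part lam j) ->
  (forall j, j.+1 < N -> nu j.+1 <= part mu j) ->
  \sum_(j < N) (nu j - part mu j) <= ncols_diff lam mu.
Proof.
move=> Pl Pm Hnu Hstrip; rewrite /ncols_diff; set M := maxn _ _.
have leM j : part lam j <= M.
  rewrite leq_max; apply/orP; left; have [ltj|gej] := ltnP j (size lam).
    by apply: leq_bigmax_seq => //; apply: mem_nth.
  by rewrite /part nth_default.
rewrite (eq_bigr (fun j : 'I_N => \sum_(c <- iota 1 M) (part mu j < c <= nu j : nat))).
  rewrite exchange_big -sum1_count [X in _ <= X]big_mkcond leq_sum //= => c _.
  case: (pickP (fun j : 'I_N => part mu j < c <= nu j)) => [j Hj|H]; last first.
    by rewrite big1 // => j _; rewrite H.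
  rewrite (bigD1 j) //= Hj big1 => [|i ne_ij].
    have /andP[lej1 lej2] := Hnu j (ltn_ord j); have /andP[Hj1 Hj2] := Hj.
    have h1 : conjp mu c <= j by apply: conjp_le.
    have h2 : j < conjp lam c.
      by apply: conjp_gt => //; [apply: leq_ltn_trans Hj1 | apply: leq_trans lej2].
    by rewrite (leq_ltn_trans h1 h2).
  have Hij (i1 i2 : 'I_N) : i1 < i2 -> nu i2 <= part mu i1.
    move=> lt12; have E2 : (i2 : nat) = i2.-1.+1 by lia.
    have ltN := ltn_ord i2; rewrite E2 in ltN *.
    by apply: leq_trans (Hstrip _ ltN) _; apply: part_le => //; rewrite -ltnS -E2.
  have {}ne_ij : (i : nat) != j by [].
  case: (ltngtP i j) ne_ij => // [/Hij|/Hij] H _; lia.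
move=> j _; have /andP[le1 le2] := Hnu j (ltn_ord j).
rewrite -(@count_interval _ _ M) ?le1 ?(leq_trans le2) //.
by rewrite -sum1_count big_mkcond; apply: eq_bigr => c _; case: ifP.
Qed.

End Partitions.

(** * Skew determinants *)

(** The new matrix is the old one times a unitriangular matrix. *)
Lemma det_sub_prev_col (R : comNzRingType) N (M : 'I_N -> nat -> R) (x : nat -> R) :
  \det (\matrix_(i < N, j < N)
          (M i j - (if (j : nat) is j'.+1 then x j * M i j' else 0)))
  = \det (\matrix_(i < N, j < N) M i j).
Proof.
pose T : 'M[R]_N := \matrix_(i, j) ((i == j)%:R - (if i.+1 == j then x j else 0)).
have detT : \det T = 1.
  rewrite -det_tr det_trig.
    rewrite big1 // => i _; rewrite !mxE eqxx gtn_eqF ?subr0 //.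
  apply/is_trig_mxP => i j lt_ij; rewrite !mxE.
  have -> : (j == i) = false by apply/eqP => E; rewrite E ltnn in lt_ij.
  by rewrite gtn_eqF ?subrr // ltnS ltnW.
rewrite -[RHS]mulr1 -detT -det_mulmx; congr (\det _); apply/matrixP => i j.
rewrite !mxE.
transitivity (\sum_(k < N) (M i k * (k == j)%:R - M i k * (if k.+1 == j then x j else 0))).
  rewrite sumrB (bigD1 j) //= eqxx mulr1 big1 ?addr0 => [|k /negbTE ->]; last by rewrite mulr0.
  congr (_ - _); case: j => [[|j] ltj] /=.
    by rewrite big1 // => k _; rewrite mulr0.
  rewrite (bigD1 (Ordinal (ltnW ltj))) //= eqxx mulrC big1 ?addr0 // => k ne_k.
  rewrite eqSS; have -> : (k == j :> nat) = false by rewrite -(negbTE ne_k).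
  by rewrite mulr0.
by apply: eq_bigr => k _; rewrite !mxE mulrBr.
Qed.

Section SkewDeterminants.
Variables (F : finFieldType) (n : nat).
Local Notation q := #|F|.
Local Notation S := (Spol F n).
Local Notation K := (Kf F n).
Local Notation io := (scal F n).
Implicit Types (U V W L : {fset S}).

(* [Hmx W a b] is phi^(b+1) H_(a-b) and [Tmx W a b] is (-1)^(a-b) phi^a E_(a-b);
   the skew functions are minors of these two lower triangular matrices.  The
   shift [N - i.+1] below is [-i] translated by N, so that indices stay in nat. *)
Definition Hmx W (a b : nat) : K :=
  if (b <= a)%N then Hfun W (a - b)%N ^+ (q ^ b.+1) else 0.
Definition Hmx_prev W (a b : nat) : K := if a is a'.+1 then Hmx W a' b else 0.
Definition Tmx W (a b : nat) : K :=
  if (b <= a)%N then (-1) ^+ (a - b) * Efun W (a - b)%N ^+ (q ^ a) else 0.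

Definition shift (l : seq nat) N i : nat := (part l i + (N - i.+1))%N.

Lemma shift_lt l N i j : is_partition l -> (i < j < N)%N ->
  (shift l N j < shift l N i)%N.
Proof.
move=> Pl /andP[lt_ij ltj]; have := part_le Pl (ltnW lt_ij); rewrite /shift; lia.
Qed.

Lemma shift_le l N i j : is_partition l -> (i <= j < N)%N ->
  (shift l N j <= shift l N i)%N.
Proof.
move=> Pl /andP[le_ij ltj]; have := part_le Pl le_ij; rewrite /shift; lia.
Qed.

Lemma Hmx_lt W a b : (a < b)%N -> Hmx W a b = 0.
Proof. by rewrite ltnNge /Hmx => /negbTE ->. Qed.

Lemma Hmx_prev_le W a b : (a <= b)%N -> Hmx_prev W a b = 0.
Proof. by case: a => // a; apply: Hmx_lt. Qed.

Lemma Tmx_lt W a b : (a < b)%N -> Tmx W a b = 0.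
Proof. by rewrite ltnNge /Tmx => /negbTE ->. Qed.

Lemma skewS_det W l m (N := maxn (plen l) (plen m)) :
  skewS W l m = (N, \det (\matrix_(i < N, j < N) Hmx W (shift l N i) (shift m N j))).
Proof.
rewrite /skewS -/N; congr (_, \det _); apply/matrixP => i j; rewrite !mxE /Hmx /qq.
have ltj := ltn_ord j; have lti := ltn_ord i.
have -> : (part m j + N - j = (shift m N j).+1)%N by rewrite /shift; lia.
case: leqP => H.
  by congr (Hfun W _ ^+ _); rewrite /shift in H *; lia.
set e := (X in Hfun W X); have : (e < 0)%R by rewrite /e; rewrite /shift in H; lia.
by case: e => // e _; rewrite /Hfun frob0.
Qed.

Lemma skewT_det W l m (N := maxn (plen l) (plen m)) :
  skewT W l m = (N, \det (\matrix_(i < N, j < N) Tmx W (shift l N i) (shift m N j))).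
Proof.
rewrite /skewT -/N; congr (_, \det _); apply/matrixP => i j; rewrite !mxE /Tmx /qq.
have ltj := ltn_ord j; have lti := ltn_ord i.
have -> : (part l i + N - i.+1 = shift l N i)%N by rewrite /shift; lia.
rewrite /=; set e : int := (X in Efun W X); rewrite -/e.
case: leqP => H.
  have -> : e = (shift l N i - shift m N j)%N by rewrite /e /shift in H *; lia.
  by [].
have : (e < 0)%R by rewrite /e; rewrite /shift in H; lia.
by case: e => // e _; rewrite [Efun _ _]/Efun frob0 mulr0.
Qed.

Section Line.
Variables (V L : {fset S}) (l : S).
Hypotheses (sV : is_subspace V) (sL : is_subspace L) (dL : sdim L = 1%N).
Hypotheses (LV : fsubset L V) (lL : l \in L) (l0 : l != 0).
Local Notation a := (toK l ^+ q.-1).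
Local Notation Q := (quot V L).
Local Notation k := (sdim V).

(** [Hfun_quot] raised to the power [q ^ B.+1]. The factor of [Hmx_prev] depends on the row index
    only, so a determinant can be expanded along its rows. *)
Lemma Hmx_quot A B : Hmx Q A B = Hmx V A B - a ^+ (q ^ (k.-1 + A)) * Hmx_prev V A B.
Proof.
have sQ := quot_subspace sL dL lL l0 sV; have dQ := sdim_quot sL dL lL l0 sV LV.
case: (ltngtP A B) => [ltAB|ltBA|->].
- by rewrite !Hmx_lt // Hmx_prev_le 1?ltnW // mulr0 subr0.
- case: A ltBA => // A; rewrite ltnS => leBA; rewrite /Hmx_prev /Hmx leBA (leqW leBA) subSn //.
  rewrite (Hfun_quot sL dL lL l0 sV LV) (frobB io) exprMn frob_comp.
  by congr (_ - _ ^+ (_ ^ _)%N * _); rewrite dQ; lia.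
by rewrite Hmx_prev_le // mulr0 subr0 /Hmx leqnn subnn !Hfun0.
Qed.

(** [Efun_quot] raised to the power [q ^ A]. Here the factor depends on the column index only. *)
Lemma Tmx_quot A B : Tmx V A B = Tmx Q A B - a ^+ (q ^ (k + B)) * Tmx Q A B.+1.
Proof.
have sQ := quot_subspace sL dL lL l0 sV; have dQ := sdim_quot sL dL lL l0 sV LV.
case: (ltngtP A B) => [ltAB|ltBA|->].
- by rewrite !Tmx_lt ?mulr0 ?subr0 // ltnW.
- rewrite /Tmx ltBA (ltnW ltBA); have [r Er] : exists r, (A - B = r.+1)%N.
    by exists (A - B).-1; lia.
  have -> : (A - B.+1 = r)%N by lia.
  rewrite Er; case: (ltnP r k) => [ltr|ger].
    rewrite (Efun_quot sL dL lL l0 sV LV ltr) (frobD io) exprMn frob_comp mulrDr.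
    congr (_ + _); rewrite exprS mulN1r mulNr mulrCA; congr (- (_ ^+ (_ ^ _)%N * _)).
    lia.
  by rewrite !Efun_gt ?frob0 ?mulr0 ?subrr //; lia.
by rewrite [Tmx Q B B.+1]Tmx_lt // mulr0 subr0 /Tmx leqnn subnn !Efun0.
Qed.

Definition linepow m B C : K := \prod_(B <= e < C) a ^+ (q ^ (m + e)).

(** Iterating [Tmx_quot] from column [B] to column [C] accumulates the factors collected in
    [linepow]. *)
Lemma Tmx_quot_telescope A B C : (B <= C)%N ->
  Tmx Q A B - linepow k B C * Tmx Q A C = \sum_(B <= c < C) linepow k B c * Tmx V A c.
Proof.
move=> leBC; rewrite -[C](subnKC leBC); elim: (C - B)%N => [|m IH].
  by rewrite addn0 /linepow !big_geq // mul1r subrr.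
rewrite addnS big_nat_recr ?leq_addr //= -IH Tmx_quot /linepow.
rewrite [in LHS]big_nat_recr ?leq_addr //= mulrBr mulrA addrA subrK.
by [].
Qed.

End Line.

Theorem skewS_sum_lines U V lam mu : is_subspace U -> is_subspace V -> fsubset U V ->
  is_partition lam -> is_partition mu -> (nrows_diff lam mu < sdim U)%N ->
  shat_eq (skewS V lam mu) (sum_lines U (fun L => skewS (quot V L) lam mu)).
Proof.
move=> sU sV UV Pl Pm bnd; set N := maxn (plen lam) (plen mu).
rewrite skewS_det -/N.
have -> : sum_lines U (fun L => skewS (quot V L) lam mu) = sum_lines U (fun L =>
    (N, \det (\matrix_(i < N, j < N) Hmx (quot V L) (shift lam N i) (shift mu N j)))).
  by apply: eq_bigr => L _; rewrite skewS_det.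
(* [f] marks the rows that take the second term of [Hmx_quot]. The matrix is transposed so that
   [det_sum_cols] applies. *)
pose coef (f : {ffun 'I_N -> bool}) : K :=
  (\prod_j (if f j then -1 else 1)) *
  \det (\matrix_(i < N, j < N) (if f j then Hmx_prev V (shift lam N j) (shift mu N i)
                                else Hmx V (shift lam N j) (shift mu N i))).
pose es (f : {ffun 'I_N -> bool}) : seq nat :=
  [seq (sdim V).-1 + shift lam N j | j : 'I_N <- enum 'I_N & f j]%N.
apply: (@sum_lines_polynomial _ _ U N _ _ _ coef es) => //.
- move=> f; apply: contraNT; rewrite -leqNgt => le_es.
  (* At least [dim U] rows are marked, more than the rows with [lam_i > mu_i], so some marked row
     has [lam_i <= mu_i]. *)
  have [i0 fi0 le_i0] : exists2 i0 : 'I_N, f i0 & (part lam i0 <= part mu i0)%N.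
    case: (pickP (fun i : 'I_N => f i && (part lam i <= part mu i)%N)) => [i /andP[]|H].
      by exists i.
    suff : (size (es f) <= nrows_diff lam mu)%N by lia.
    rewrite size_map size_filter /nrows_diff.
    have [M' EM] : exists M', maxn (size lam) (size mu) = (N + M')%N.
      exists (maxn (size lam) (size mu) - N)%N; rewrite subnKC // /N geq_max.
      by rewrite !leq_max !count_size orbT.
    rewrite EM iotaD count_cat -val_enum_ord count_map.
    apply: leq_trans (leq_addr _ _); apply: sub_count => i /= fi.
    by have := H i; rewrite fi /= leqNgt => /negbFE.
  (* For rows from [i0] on and columns up to [i0], the row index is at most the column index.
     Equality can occur only in row [i0], which is marked, and [Hmx_prev] vanishes there too. *)
  apply/eqP; rewrite /coef -det_tr (@det_zero_block _ _ _ i0) ?mulr0 // => r c ler lec.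
  rewrite !mxE; have ltr := ltn_ord r; have lti := ltn_ord i0.
  have le1 : (shift lam N i0 <= shift mu N c)%N.
    apply: (@leq_trans (shift mu N i0)); first by rewrite /shift leq_add2r.
    by apply: shift_le => //; rewrite lec ltn_ord.
  have [Er|ne] := eqVneq (r : nat) i0.
    have -> : r = i0 by apply: val_inj.
    by rewrite fi0 Hmx_prev_le.
  have lt2 : (shift lam N r < shift lam N i0)%N.
    by apply: shift_lt => //; rewrite ltr andbT ltn_neqAle eq_sym ne.
  have lt3 := leq_trans lt2 le1.
  by rewrite Hmx_lt // Hmx_prev_le ?if_same // ltnW.
- move=> L l sL dL LU lL l0; have LV := fsubset_trans LU UV.
  rewrite -det_tr; pose x (j : 'I_N) (c : bool) : K :=
    if c then - (toK l ^+ q.-1) ^+ (q ^ ((sdim V).-1 + shift lam N j)) else 1.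
  pose G (i j : 'I_N) (c : bool) : K :=
    if c then Hmx_prev V (shift lam N j) (shift mu N i) else Hmx V (shift lam N j) (shift mu N i).
  transitivity (\det (\matrix_(i < N, j < N) \sum_c x j c * G i j c)).
    congr (\det _); apply/matrixP => i j; rewrite !mxE (Hmx_quot sV sL dL LV lL l0).
    by rewrite big_bool /x /G mul1r mulNr addrC.
  rewrite det_sum_cols; apply: eq_bigr => f _; rewrite /coef mulrAC; congr (_ * _).
  rewrite /es big_map big_filter big_enum_cond /= [X in _ = _ * X]big_mkcond -big_split.
  by apply: eq_bigr => j _; rewrite /x; case: (f j) => /=; rewrite ?mulN1r ?mulr1.
(* The constant term comes from marking no row. *)
rewrite (big_pred1 [ffun=> false]) /coef => [|f].
  rewrite big1 ?mul1r => [|j _]; last by rewrite ffunE.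
  by rewrite -det_tr; congr (\det _); apply/matrixP => i j; rewrite !mxE ffunE.
apply/eqP/eqP => [Ef|->].
  apply/ffunP => j; rewrite ffunE; apply/negbTE/negP => fj.
  have : (shift lam N j + (sdim V).-1)%N \in es f.
    by rewrite addnC; apply: map_f; rewrite mem_filter fj mem_enum.
  by rewrite Ef.
rewrite /es (eq_filter (a2 := pred0)) ?filter_pred0 // => j.
by rewrite ffunE.
Qed.

Theorem skewT_sum_lines U V lam mu : is_subspace U -> is_subspace V -> fsubset U V ->
  is_partition lam -> is_partition mu -> (ncols_diff lam mu < sdim U)%N ->
  shat_eq (skewT V lam mu) (sum_lines U (fun L => skewT (quot V L) lam mu)).
Proof.
move=> sU sV UV Pl Pm bnd; set N := maxn (plen lam) (plen mu).
rewrite skewT_det -/N.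
have -> : sum_lines U (fun L => skewT (quot V L) lam mu) = sum_lines U (fun L =>
    (N, \det (\matrix_(i < N, j < N) Tmx (quot V L) (shift lam N i) (shift mu N j)))).
  by apply: eq_bigr => L _; rewrite skewT_det.
(* [M] exceeds every row and column index; it plays the role of the missing index before the first
   column. *)
pose M := (part lam 0 + part mu 0 + N).+1.
have ltM j : (j < N)%N -> (shift lam N j < M)%N /\ (shift mu N j < M)%N.
  move=> ltj; have := part_le Pl (leq0n j); have := part_le Pm (leq0n j).
  by rewrite /M /shift; lia.
pose ub j := if j is j'.+1 then shift mu N j' else M.
have ubM j : (j < N)%N -> (ub j <= M)%N.
  by case: j => // j ltj; have [] := ltM j (ltnW ltj); rewrite /= => _ /ltnW.
have lt_ub j : (j < N)%N -> (shift mu N j < ub j)%N.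
  case: j => [|j] ltj /=; first by have [] := ltM 0%N ltj.
  by apply: shift_lt => //; rewrite ltnSn ltj.
(* The admissible choices take for column [j] an index from its own interval, so [f] is
   decreasing. *)
pose ok (f : {ffun 'I_N -> 'I_M}) := [forall j : 'I_N, shift mu N j <= f j < ub j]%N.
pose coef (f : {ffun 'I_N -> 'I_M}) : K :=
  if ok f then \det (\matrix_(i < N, j < N) Tmx V (shift lam N i) (f j)) else 0.
pose es (f : {ffun 'I_N -> 'I_M}) : seq nat :=
  flatten [seq [seq (sdim V + e)%N | e <- index_iota (shift mu N j) (f j)] | j : 'I_N <- enum 'I_N].
have size_es f : size (es f) = (\sum_(j < N) (f j - shift mu N j))%N.
  rewrite size_flatten /shape -map_comp sumnE big_map big_enum /=.
  by apply: eq_bigr => j _; rewrite size_map size_iota.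
apply: (@sum_lines_polynomial _ _ U N _ _ _ coef es) => //.
- move=> f; rewrite /coef; case: ifP => [/forallP okf|_]; last by rewrite eqxx.
  move=> nz; apply: leq_ltn_trans bnd; rewrite size_es.
  (* Otherwise rows from [j] on have indices below those of the columns up to [j], and the zero
     block kills the minor. *)
  have le_f (j : 'I_N) : (f j <= shift lam N j)%N.
    rewrite leqNgt; apply/negP => lt_j; case/eqP: nz.
    apply: (@det_zero_block _ _ _ j) => r c ler lec; rewrite !mxE Tmx_lt //.
    have le1 : (shift lam N r <= shift lam N j)%N.
      by apply: shift_le => //; rewrite ler ltn_ord.
    apply: leq_ltn_trans le1 (leq_trans lt_j _).
    have [Ec|ne] := eqVneq (c : nat) j; first by rewrite (val_inj Ec).
    have ltc : (c < j)%N by rewrite ltn_neqAle ne.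
    have /andP[le_c _] := okf c; have /andP[_] := okf j.
    have Ej : (j : nat) = j.-1.+1 by lia.
    rewrite {1}Ej /= => ltfj; apply: leq_trans (ltnW ltfj) (leq_trans _ le_c).
    by apply: shift_le => //; have := ltn_ord j; lia.
  (* Removing the staircase from [f] gives [nu] between [mu] and [lam], with [nu/mu] a horizontal
     strip of [size (es f)] cells. *)
  pose nu j := (oapp (fun j' : 'I_N => f j' - (N - j'.+1)) 0 (insub j))%N.
  have nuE (j : 'I_N) : nu j = (f j - (N - j.+1))%N by rewrite /nu valK.
  apply: leq_trans (@horizontal_strip_size lam mu N nu Pl Pm _ _).
  + by apply: leq_sum => j _; rewrite nuE /shift addnC subnDA.
  + move=> j ltj; have /andP[+ _] := okf (Ordinal ltj); have := le_f (Ordinal ltj).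
    by rewrite (nuE (Ordinal ltj)) /shift /=; lia.
  move=> j ltj; have /andP[] := okf (Ordinal ltj); rewrite (nuE (Ordinal ltj)) /shift /=.
  by rewrite /shift; lia.
- move=> L l sL dL LU lL l0; have LV := fsubset_trans LU UV.
  pose pw := linepow l (sdim V).
  (* Subtracting the multiple of the previous column given by [linepow] makes each column a
     telescoped sum of columns for [V]. In the first column the boundary term at [M] vanishes. *)
  rewrite -(@det_sub_prev_col _ _
    (fun i j => Tmx (quot V L) (shift lam N i) (shift mu N j)) (fun j => pw (shift mu N j) (shift mu N j.-1))).
  pose x (j : 'I_N) (c : 'I_M) : K :=
    if (shift mu N j <= c < ub j)%N then pw (shift mu N j) c else 0.
  pose G (i j : 'I_N) (c : 'I_M) : K := Tmx V (shift lam N i) c.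
  transitivity (\det (\matrix_(i < N, j < N) \sum_c x j c * G i j c)).
    congr (\det _); apply/matrixP => i j; rewrite !mxE.
    transitivity (\sum_(shift mu N j <= c < ub j) pw (shift mu N j) c * Tmx V (shift lam N i) c).
      rewrite -(Tmx_quot_telescope sV sL dL LV lL l0) ?(ltnW (lt_ub _ _)) //.
      case: j => [[|j] ltj] //=; rewrite [Tmx _ _ M]Tmx_lt ?mulr0 //.
      by have [] := ltM i (ltn_ord i).
    rewrite (big_nat_widen _ _ _ _ _ (ubM j (ltn_ord j))) (big_nat_widenl _ 0%N) //.
    rewrite big_mkord big_mkcond; apply: eq_bigr => c _; rewrite /x /G andbC.
    by case: ifP => _ //=; rewrite mul0r.
  rewrite det_sum_cols; apply: eq_bigr => f _; rewrite /coef mulrC.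
  case: ifP => [/forallP okf|/negbT]; last first.
    rewrite negb_forall => /existsP[j /negbTE nj].
    by rewrite (bigD1 j) //= /x nj !mul0r mulr0.
  congr (_ * _); rewrite /es big_flatten big_map big_enum /=.
  by apply: eq_bigr => j _; rewrite /x okf /pw /linepow big_map.
(* [f0] keeps the original column indices; any other [f] with empty monomial falls below its
   interval somewhere and has coefficient 0. *)
pose f0 : {ffun 'I_N -> 'I_M} := [ffun j : 'I_N => inord (shift mu N j)].
have f0E j : f0 j = shift mu N j :> nat.
  by rewrite ffunE inordK //; have [] := ltM j (ltn_ord j).
rewrite (bigD1 f0) /=; last first.
  by rewrite -size_eq0 size_es big1 // => j _; rewrite f0E subnn.
rewrite big1 ?addr0 => [|f /andP[/eqP esf nef]].
  rewrite /coef; case: ifP => [_|/forallP[] j]; last by rewrite f0E leqnn lt_ub.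
  by congr (\det _); apply/matrixP => i j; rewrite !mxE f0E.
rewrite /coef; case: ifP => // /forallP okf; case/eqP: nef; apply/ffunP => j.
apply/val_inj; rewrite /= f0E; have := size_es f; rewrite esf /= (bigD1 j) //=.
by have /andP[] := okf j; lia.
Qed.

End SkewDeterminants.

Local Open Scope fset_scope.

Theorem mainTheorem6 (F : finFieldType) (n : nat)
  (U V : {fset Spol F n}) (lam mu : seq nat) :
  is_subspace U -> is_subspace V -> U `<=` V ->
  is_partition lam -> is_partition mu -> psubset mu lam ->
  ((nrows_diff lam mu < sdim U)%N ->
     shat_eq (skewS V lam mu) (sum_lines U (fun L => skewS (quot V L) lam mu)))
  /\
  ((ncols_diff lam mu < sdim U)%N ->
     shat_eq (skewT V lam mu) (sum_lines U (fun L => skewT (quot V L) lam mu))).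
Proof.
move=> sU sV UV Pl Pm _; split=> bnd; first exact: skewS_sum_lines.
exact: skewT_sum_lines.
Qed.
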